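(* Let $q,r\ge 2$ be integers, $b=qr$, and let $\Lambda\subset\mathbb{R}$ be a countable set with $0\in\Lambda$. Then $\Lambda$ is a maximal orthogonal set of $L^2(\mu_{q,b})$ if and only if there exists a maximal mapping $\tau$ such that $\Lambda=r\Lambda(\tau)$.
   Context: $\mu_{q,b}$ is the unique Borel probability measure $\mu$ on $\mathbb{R}$ satisfying $\mu(E)=\sum_{i=0}^{q-1}\frac1q\,\mu(f_i^{-1}(E))$ for all Borel $E$, where $f_i(x)=b^{-1}(x+i)$. A countable set $\Lambda\subset\mathbb{R}$ is a maximal orthogonal set of $L^2(\mu)$ if the functions $e_\lambda(x)=e^{2\pi i\lambda x}$, $\lambda\in\Lambda$, are mutually orthogonal in $L^2(\mu)$ and for every $\alpha\in\mathbb{R}\setminus\Lambda$, $e_\alpha$ is not orthogonal to some $e_\lambda$, $\lambda\in\Lambda$. Words: $\Sigma_q=\{0,\dots,q-1\}$; $\Sigma_q^n$ is the set of words of length $n$; $\Sigma_q^0=\{\vartheta\}$ with $\vartheta$ the empty word; $\Sigma_q^*=\bigcup_{n\ge0}\Sigma_q^n$. For a finite or infinite word $\sigma=\sigma_1\sigma_2\cdots$, $\sigma|_k=\sigma_1\cdots\sigma_k$ (and $\sigma|_0=\vartheta$). Juxtaposition is concatenation, $0^k$ is the word of $k$ zeros, $0^\infty=000\cdots$. $\Gamma_q=\{\sigma0^\infty:\sigma=\sigma_1\cdots\sigma_k\in\Sigma_q^*,\ \sigma_k\ne0\}$, where $\sigma=\vartheta$ is allowed, so $0^\infty\in\Gamma_q$;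 i.e. $\Gamma_q$ is the set of infinite words that are eventually $0$. Let $\mathcal{C}=\{-1,0,1,\dots,b-2\}$ and $\mathcal{C}_i=(i+q\mathbb{Z})\cap\mathcal{C}$ for $i=0,\dots,q-1$. A map $\tau:\Sigma_q^*\to\mathcal{C}$ is regular on $\sigma\in\Gamma_q$ if $\tau(\sigma|_k)=0$ for all sufficiently large $k$. The map $\tau$ is a maximal mapping if: (i) $\tau(\vartheta)=\tau(0^n)=0$ for all $n\ge1$; (ii) $\tau(\sigma_1\cdots\sigma_k)\in\mathcal{C}_{\sigma_k}$ for all $k\ge1$ and all $\sigma_1\cdots\sigma_k\in\Sigma_q^k$; (iii) for any $\sigma\in\Sigma_q^*$ there exists $\sigma'\in\Sigma_q^*$ such that $\tau$ is regular on $\sigma\sigma'0^\infty$. If $\tau$ is regular on $\sigma\in\Gamma_q$, put $\Pi^\tau_b(\sigma)=\sum_{k=1}^\infty\tau(\sigma|_k)b^{k-1}$ (a finite sum). Define $\Lambda(\tau)=\{\Pi^\tau_b(\sigma):\sigma\in\Gamma_q,\ \tau\text{ is regular on }\sigma\}$, and $r\Lambda(\tau)=\{r\lambda:\lambda\in\Lambda(\tau)\}$. *)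

(* Defs.v *)
From mathcomp Require Import all_boot all_order all_algebra.
From mathcomp Require Import all_classical all_reals all_analysis.
From mathcomp Require Import complex.
Set Implicit Arguments.
Unset Strict Implicit.
Unset Printing Implicit Defensive.
Import Order.TTheory GRing.Theory Num.Theory.
Import numFieldNormedType.Exports.
Local Open Scope classical_set_scope.
Local Open Scope ring_scope.

Section CantorMeasure.
Variables (R : realType) (q b : nat).

Definition ifs_map (i : nat) (x : R) : R := b%:R^-1 * (x + i%:R).

(* By Hutchinson's theorem exactly one Borel probability measure, mu_{q,b},
   satisfies this. *)
Definition is_cantor_measure (mu : probability (measurableTypeR R) R) : Prop :=
  forall E : set (measurableTypeR R), measurable E ->
    mu E = (\sum_(i < q) (q%:R^-1)%:E * mu (ifs_map i @^-1` E))%E.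

End CantorMeasure.

Section OrthogonalExponentials.
Variables (R : realType) (mu : probability (measurableTypeR R) R).

(* The integral library covers real-valued functions only, so complex
   functions are integrated componentwise. *)
Definition cintegral (f : R -> R[i]) : R[i] :=
  Complex (\int[mu]_x complex.Re (f x)) (\int[mu]_x complex.Im (f x)).

Definition L2_inner (f g : R -> R[i]) : R[i] :=
  cintegral (fun x => f x * (g x)^*%C).

Definition L2_orthogonal (f g : R -> R[i]) : Prop := L2_inner f g = 0.

Definition expo (lambda x : R) : R[i] :=
  Complex (cos (2 * pi * lambda * x)) (sin (2 * pi * lambda * x)).

Definition maximal_orthogonal (Lambda : set R) : Prop :=
  (forall l l', Lambda l -> Lambda l' -> l != l' ->
     L2_orthogonal (expo l) (expo l')) /\
  (forall a, ~ Lambda a ->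
     exists2 l, Lambda l & ~ L2_orthogonal (expo a) (expo l)).

End OrthogonalExponentials.

Section MaximalMappings.
Variables (q b : nat) (q_gt1 : (1 < q)%N).

(* Letters are 'I_q, finite words are sequences of letters.  An infinite word
   s is a function on nat, with s n its letter number n+1. *)
Definition letter0 : 'I_q := Ordinal (ltnW q_gt1).

Definition infword := nat -> 'I_q.

Definition pad0 (w : seq 'I_q) : infword := nth letter0 w.

Definition initial (s : infword) (k : nat) : seq 'I_q := mkseq s k.

Definition Gamma : set infword :=
  [set pad0 w | w in [set w | w = [::] \/ last letter0 w != letter0]].

Definition digits : set int := [set z | -1 <= z <= b%:Z - 2].

Definition digit_class (i : 'I_q) : set int :=
  [set z | exists m : int, z = i%:Z + q%:Z * m] `&` digits.

Definition regular (tau : seq 'I_q -> int) (s : infword) : Prop :=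
  exists N : nat, forall k, (N <= k)%N -> tau (initial s k) = 0.

Definition maximal_mapping (tau : seq 'I_q -> int) : Prop :=
  [/\ forall w, digits (tau w),
      tau [::] = 0 /\ (forall n, (1 <= n)%N -> tau (nseq n letter0) = 0),
      forall (w : seq 'I_q) (i : 'I_q), digit_class i (tau (rcons w i)) &
      forall w, exists w', regular tau (pad0 (w ++ w'))].

(* The summand of index k is the term of index k+1 of the usual series.  The
   sum has finite support when tau is regular on s, the only case used. *)
Definition Pi (tau : seq 'I_q -> int) (s : infword) : int :=
  \sum_(k \in [set: nat]) (tau (initial s k.+1) * b%:Z ^+ k).

Definition Lambda_of (R : realType) (tau : seq 'I_q -> int) : set R :=
  [set (Pi tau s)%:~R | s in [set s | Gamma s /\ regular tau s]].

End MaximalMappings.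

Arguments Lambda_of {q} b q_gt1 R tau.
Arguments maximal_mapping {q} b q_gt1 tau.

(* Main.v *)
Require Import Defs.
From mathcomp Require Import all_boot all_order all_algebra.
From mathcomp Require Import all_classical all_reals all_analysis.
From mathcomp Require Import measurable_realfun complex.
From mathcomp Require Import zify ring lra.
Set Implicit Arguments.
Unset Strict Implicit.
Unset Printing Implicit Defensive.
Import Order.TTheory GRing.Theory Num.Theory.
Local Open Scope classical_set_scope.
Local Open Scope ring_scope.

(** The proof has an analytic half, which turns orthogonality into a divisibility
    property of integers, and a combinatorial half, which reads that property
    off digit expansions.

    Analysis.  The inner product of two exponentials is the Fourier transform F
    of the measure at the difference xi of the frequencies.  Self-similarity
    gives F(xi) = M(xi / b) F(xi / b), where M(t) is the mean of the numbers
    e^(2 pi i k t), k < q ([fourier_eq]).  Iterating, F(xi) is a finite product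
    of values of M times F(xi / b^n), and the last factor is nonzero for some n
    because F(xi / b^n) tends to F(0) = 1 ([fourier_nonzero_near0]).  So the
    zeros of F come from those of M, which form a geometric sum:  M(t) = 0 iff
    q t is an integer not divisible by q ([sum_expo_eq0]).  As b = q r, distinct
    frequencies s, t are orthogonal iff s - t = r d, where d is an integer of the
    form b^k m with m not divisible by q; such a d is called admissible here
    ([L2_orthogonal_expo]).  A set containing 0 is therefore maximal orthogonal
    iff it is r A for a set A of integers that is maximal among the sets with
    pairwise admissible differences ([maximal_orthogonalP]).

    Combinatorics.  Every integer has exactly one expansion in base b with digits
    in -1, 0, ..., b - 2 that are eventually 0.  If the expansions of n and n'
    first differ at index j, then n - n' is b^j times a number congruent to the
    difference of the two digits modulo b, so n - n' is admissible iff these two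
    digits differ modulo q ([admissible_first_diff]).  Recording only the
    residues modulo q of the digits gives the coding of an integer, an infinite
    word over q letters; a mapping tau decorates the q-ary tree of words with
    digits, and Pi(tau, s) is the integer whose coding is s and whose digits are
    read along s ([digit_Pi], [coding_Pi]).

    If tau is maximal, two integers read from tau have distinct letters where
    they first differ, and an integer that leaves the tree at some vertex
    disagrees there with a label congruent to its digit modulo q; any integer
    read through that vertex, which exists by the third axiom, is at an
    inadmissible difference ([follows_maximal]).  Conversely, in a maximal
    admissible set A every word begins the coding of an element of A, since
    otherwise an integer could be added to A ([every_word_coded]), and the
    elements with a given initial coding word share their digits there
    ([digit_eq_initial]); labelling each word with the common digit gives tau
    ([mapping_of_maximal], [mapping_of_follows]). *)

(** * Expansions in base b with digits -1, ..., b - 2 *)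

Section BalancedDigits.
Variable b : nat.

(** The digit congruent to [n] modulo [b]; adding 1 before the Euclidean division
    and subtracting it afterwards shifts the digits 0, ..., b - 1 to
    -1, ..., b - 2. *)
Definition low_digit (n : int) : int := ((n + 1) %% b)%Z - 1.
Definition shift (n : int) : int := ((n + 1) %/ b)%Z.
Definition digit (n : int) (k : nat) : int := low_digit (iter k shift n).

Lemma low_digit_shift n : n = low_digit n + b%:Z * shift n.
Proof.
rewrite /low_digit /shift; have := divz_eq (n + 1) b; lia.
Qed.

Lemma digitS n k : digit n k.+1 = digit (shift n) k.
Proof. by rewrite /digit iterSr. Qed.

Lemma digit_expansion n N :
  n = \sum_(k < N) digit n k * b%:Z ^+ k + b%:Z ^+ N * iter N shift n.
Proof.
elim: N => [|N IH]; first by rewrite big_ord0 expr0 mul1r add0r.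
rewrite {1}IH big_ord_recr /= [X in _ + _ * X = _]low_digit_shift /digit exprSr.
ring.
Qed.

Hypothesis b_gt2 : (2 < b)%N.

Lemma digits_digit n k : digits b (digit n k).
Proof.
rewrite /digit /low_digit /digits /=; move: (iter k shift n) => m.
have := modz_ge0 (m + 1) (_ : b%:Z != 0).
have := ltz_pmod (m + 1) (_ : 0 < b%:Z).
lia.
Qed.

Lemma digits0 : digits b 0.
Proof. rewrite /digits /=; lia. Qed.

Lemma shift_digitsD c m : digits b c -> shift (c + b%:Z * m) = m.
Proof.
rewrite /digits /= => cb; rewrite /shift.
have -> : c + b%:Z * m + 1 = m * b%:Z + (c + 1) by ring.
rewrite divzMDl; last lia.
by rewrite divz_small ?addr0; lia.
Qed.

Lemma low_digit_digitsD c m : digits b c -> low_digit (c + b%:Z * m) = c.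
Proof.
move=> cb; have := low_digit_shift (c + b%:Z * m).
by rewrite shift_digitsD//; lia.
Qed.

Lemma iter_shift0 k : iter k shift 0 = 0.
Proof.
elim: k => //= k ->.
by have := shift_digitsD 0 digits0; rewrite mulr0 addr0.
Qed.

Lemma low_digit0 : low_digit 0 = 0.
Proof. by have := low_digit_digitsD 0 digits0; rewrite mulr0 addr0. Qed.

Lemma digit_0 k : digit 0 k = 0.
Proof. by rewrite /digit iter_shift0 low_digit0. Qed.

(** Expansions terminate because [shift] decreases the absolute value of a nonzero
    integer: |shift n| <= (|n| + b - 2) / b, and b - 2 < (b - 1) |n|.  The digit
    b - 1 is excluded, so -1 is not a fixed point. *)
Lemma iter_shift_eventually0 n :
  exists N, forall k, (N <= k)%N -> iter k shift n = 0.
Proof.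
have [m] := ubnP `|n|%N; elim: m n => // m IH n nm.
have [->|n0] := eqVneq n 0; first by exists 0%N => k _; exact: iter_shift0.
have /IH[N HN] : (`|shift n| < m)%N.
  have := low_digit_shift n; have := digits_digit n 0.
  rewrite /digits /digit /=; move: (low_digit n) (shift n) => c s cb ns.
  have : (b * `|s| <= `|n| + (b - 2))%N.
    rewrite -[b in X in (X <= _)%N]absz_nat -abszM; lia.
  nia.
exists N.+1 => -[//|k] Nk; rewrite iterSr; exact: HN.
Qed.

Lemma digit_eventually0 n : exists N, forall k, (N <= k)%N -> digit n k = 0.
Proof.
have [N HN] := iter_shift_eventually0 n.
by exists N => k /HN; rewrite /digit => ->; exact: low_digit0.
Qed.

Lemma digit_inj n n' : (forall k, digit n k = digit n' k) -> n = n'.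
Proof.
move=> nn'; have [N HN] := iter_shift_eventually0 n.
have [N' HN'] := iter_shift_eventually0 n'.
rewrite (digit_expansion n (maxn N N')) (digit_expansion n' (maxn N N')).
rewrite HN ?leq_maxl// HN' ?leq_maxr// !mulr0.
by congr (_ + _); apply: eq_bigr => k _; rewrite nn'.
Qed.

Lemma digit_sum (c : nat -> int) N j : (forall k, digits b (c k)) ->
  digit (\sum_(k < N) c k * b%:Z ^+ k) j = if (j < N)%N then c j else 0.
Proof.
elim: N c j => [|N IH] c j cb; first by rewrite big_ord0 digit_0.
have -> : \sum_(k < N.+1) c k * b%:Z ^+ k =
    c 0%N + b%:Z * \sum_(k < N) c k.+1 * b%:Z ^+ k.
  rewrite big_ord_recl expr0 mulr1 mulr_sumr; congr (_ + _).
  by apply: eq_bigr => k _; rewrite /bump/= exprS; ring.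
case: j => [|j]; first by rewrite /digit /= low_digit_digitsD.
by rewrite digitS shift_digitsD// (IH (fun k => c k.+1)).
Qed.

Definition differ_first n n' j :=
  (forall k, (k < j)%N -> digit n k = digit n' k) /\ digit n j <> digit n' j.

Lemma differ_first_exists n n' : n <> n' -> exists j, differ_first n n' j.
Proof.
move=> nn'; have ex : exists j, digit n j != digit n' j.
  apply: contrapT => /forallNP H; apply: nn'; apply: digit_inj => k.
  by apply/eqP; apply/negPn/negP; exact: H.
case: (ex_minnP ex) => j jd jmin; exists j; split; last exact/eqP.
move=> k kj; apply/eqP; apply: contraTT kj => /jmin; by rewrite -leqNgt.
Qed.

Variable q : nat.
Hypothesis q_dvd_b : (q %| b)%N.

Definition admissible (d : int) : Prop :=
  exists k (m : int), ~~ (q %| m)%Z /\ d = b%:Z ^+ k * m.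

(** When [b] does not divide [u], the power of [b] in a representation
    [b ^ k * m] with [m] not divisible by [q] is forced, because [q] divides [b]. *)
Lemma admissible_mulXn j (u : int) :
  ~~ (b %| u)%Z -> admissible (b%:Z ^+ j * u) <-> ~~ (q %| u)%Z.
Proof.
move=> bu; split=> [[k [m [qm /eqP]]]|qu]; last by exists j, u.
have b0 p : b%:Z ^+ p != 0 by rewrite expf_eq0; lia.
have qb (p : nat) (x : int) : (q %| b%:Z ^+ p.+1 * x)%Z.
  rewrite exprS -mulrA; apply: dvdz_mulr; exact: q_dvd_b.
have [kj|jk|->] := ltngtP k j.
- rewrite -(subnKC (ltnW kj)) exprD -mulrA (inj_eq (mulfI (b0 k))) => /eqP um.
  move: qm; rewrite -um; move: kj; rewrite -subn_gt0.
  by case: (j - k)%N => // p _; rewrite qb.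
- rewrite -(subnKC (ltnW jk)) exprD -mulrA (inj_eq (mulfI (b0 j))) => /eqP um.
  move: bu; rewrite um; move: jk; rewrite -subn_gt0.
  by case: (k - j)%N => // p _; rewrite exprS -mulrA dvdz_mulr.
- by rewrite (inj_eq (mulfI (b0 j))) => /eqP ->.
Qed.

(** The quotient of [n - n'] by [b ^ j] is congruent modulo [b] to the difference of
    the two digits, which is nonzero and smaller than [b] in absolute value. *)
Lemma admissible_first_diff n n' j : differ_first n n' j ->
  admissible (n - n') <-> ~~ (q %| digit n j - digit n' j)%Z.
Proof.
move=> [same diff].
have -> : n - n' = b%:Z ^+ j * (iter j shift n - iter j shift n').
  rewrite {1}(digit_expansion n j) {1}(digit_expansion n' j) mulrBr.
  have -> : \sum_(k < j) digit n k * b%:Z ^+ k =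
            \sum_(k < j) digit n' k * b%:Z ^+ k.
    by apply: eq_bigr => k _; rewrite same.
  ring.
have := digits_digit n j; have := digits_digit n' j; move: diff.
rewrite /digits /digit /=.
move: (iter j shift n) (iter j shift n') => x y.
have := low_digit_shift x; have := low_digit_shift y.
move: (low_digit x) (low_digit y) (shift x) (shift y) => c d s t -> -> cd db cb.
have -> : c + b%:Z * s - (d + b%:Z * t) = (s - t) * b%:Z + (c - d) by ring.
rewrite admissible_mulXn.
  rewrite rpredDl//.
  by apply: dvdz_mull; exact: q_dvd_b.
rewrite rpredDl ?dvdz_mull//; apply/negP => /dvdzP[z czd].
have [z0|[z1|z1]] : z = 0 \/ (1 <= z \/ z <= -1) by lia.
- by apply: cd; move: czd; rewrite z0; lia.
- by nia.
- by nia.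
Qed.

End BalancedDigits.

(** * Words and residues modulo q *)

Section Words.
Variables (q : nat) (q_gt1 : (1 < q)%N).
Local Notation letter0 := (letter0 q_gt1).
Local Notation pad0 := (pad0 q_gt1).

Lemma eq_initial (s s' : infword q) n :
  initial s n = initial s' n <-> forall k, (k < n)%N -> s k = s' k.
Proof.
split=> [ss' k kn|ss'].
  by rewrite -(nth_mkseq (s k) s kn) -(nth_mkseq (s k) s' kn); congr nth.
by apply/eq_in_map => k; rewrite mem_iota => /andP[_]; exact: ss'.
Qed.

Lemma initialS (s : infword q) n : initial s n.+1 = rcons (initial s n) (s n).
Proof. by rewrite /initial /mkseq -{1}addn1 iotaD map_cat cats1. Qed.

Lemma size_initial (s : infword q) n : size (initial s n) = n.
Proof. exact: size_mkseq. Qed.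

Lemma pad0_initial (s : infword q) N :
  (forall k, (N <= k)%N -> s k = letter0) -> pad0 (initial s N) = s.
Proof.
move=> sN; apply/funext => k; rewrite /Defs.pad0.
have [Nk|kN] := leqP N k; last exact: nth_mkseq.
by rewrite nth_default ?size_initial// sN.
Qed.

Lemma initial_pad0_cat (w w' : seq 'I_q) k : (k <= size w)%N ->
  initial (pad0 (w ++ w')) k = take k w.
Proof.
move=> kw; apply: (@eq_from_nth _ letter0); first by rewrite size_initial size_takel.
move=> i; rewrite size_initial => ik.
by rewrite nth_mkseq// nth_take// /Defs.pad0 nth_cat (leq_trans ik kw).
Qed.

Lemma initial_cut (s : infword q) n N : (n <= N)%N ->
  exists w', initial s N = initial s n ++ w'.
Proof.
move=> nN; exists (mkseq (fun k => s (n + k)%N) (N - n)).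
rewrite -{1}(subnKC nN) /initial /mkseq iotaD map_cat; congr (_ ++ _).
by rewrite add0n -[X in iota X]addn0 iotaDl -map_comp.
Qed.

Lemma Gamma_eventually0 (s : infword q) N :
  (forall k, (N <= k)%N -> s k = letter0) -> Gamma q_gt1 s.
Proof.
elim: N => [|N IH] sN.
  by exists [::]; [left|exact: (@pad0_initial _ 0%N)].
have [sN0|sN0] := eqVneq (s N) letter0.
  apply: IH => k; rewrite leq_eqVlt => /orP[/eqP<-//|]; exact: sN.
exists (initial s N.+1); last exact: pad0_initial.
by right; rewrite initialS last_rcons.
Qed.

Definition residue (z : int) : 'I_q := insubd letter0 `|(z %% q)%Z|%N.

Lemma val_residue z : (residue z : nat)%:Z = (z %% q)%Z.
Proof.
have ge0 := modz_ge0 z (_ : q%:Z != 0); have lt := ltz_pmod z (_ : 0 < q%:Z).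
by rewrite /residue val_insubd; case: ifP; lia.
Qed.

Lemma eq_residue z z' : residue z = residue z' <-> (q %| z - z')%Z.
Proof.
rewrite -eqz_mod_dvd; split=> [zz'|/eqP zz'].
  by rewrite -!val_residue zz'.
by rewrite /residue zz'.
Qed.

Lemma residue_ord (i : 'I_q) : residue (i : nat)%:Z = i.
Proof.
apply/val_inj/eqP; rewrite -eqz_nat val_residue modz_small//.
by rewrite lez_nat ltz_nat /=.
Qed.

Lemma residue0 : residue 0 = letter0.
Proof. by rewrite -[RHS]residue_ord. Qed.

Lemma digit_classE b (i : 'I_q) z :
  digit_class b i z <-> digits b z /\ residue z = i.
Proof.
split=> [[[m ->] zb]|[zb <-]]; split=> //.
  rewrite -[RHS]residue_ord; apply/eq_residue; rewrite addrAC subrr add0r.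
  exact: dvdz_mulr.
by exists (z %/ q)%Z; rewrite val_residue mulrC addrC -divz_eq.
Qed.

End Words.

(** * Maximal admissible sets and maximal mappings *)

Section MaximalSets.
Variables (q b : nat) (q_gt1 : (1 < q)%N).
Hypotheses (q_lt_b : (q < b)%N) (q_dvd_b : (q %| b)%N).
Local Notation letter0 := (letter0 q_gt1).
Local Notation pad0 := (pad0 q_gt1).
Local Notation residue := (residue q_gt1).
Local Notation digit := (digit b).
Local Notation admissible := (admissible b q).

Let b_gt2 : (2 < b)%N. Proof. exact: leq_ltn_trans q_gt1 q_lt_b. Qed.

Definition coding (n : int) : infword q := fun k => residue (digit n k).

(** The digits of [n] are the labels that [tau] puts on the prefixes of the coding
    of [n]. *)
Definition follows (tau : seq 'I_q -> int) (n : int) : Prop :=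
  forall k, digit n k = tau (initial (coding n) k.+1).

Definition maximal_admissible (A : set int) : Prop :=
  (forall n n', A n -> A n' -> n <> n' -> admissible (n - n')) /\
  (forall n, ~ A n -> exists2 n', A n' & ~ admissible (n - n')).

Lemma coding_eventually0 n :
  exists N, forall k, (N <= k)%N -> coding n k = letter0.
Proof.
have [N HN] := digit_eventually0 b_gt2 n.
by exists N => k /HN; rewrite /coding => ->; exact: residue0.
Qed.

Lemma first_diff_admissible n n' j : differ_first b n n' j ->
  admissible (n - n') <-> coding n j <> coding n' j.
Proof.
move=> nn'; rewrite (admissible_first_diff b_gt2 q_dvd_b nn').
split=> [/negP H cc|H]; first by apply: H; apply/(eq_residue q_gt1); exact: cc.
by apply/negP => cc; apply: H; apply/(eq_residue q_gt1).
Qed.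

(** The form in which inadmissible differences are used: the codings agree up to
    and including the index where the digits first differ. *)
Lemma not_admissible_first_diff n n' : n <> n' -> ~ admissible (n - n') ->
  exists2 j, differ_first b n n' j &
    initial (coding n) j.+1 = initial (coding n') j.+1.
Proof.
move=> /(differ_first_exists b_gt2)[j nn'] /(first_diff_admissible nn').
move=> /contrapT cj; exists j => //; apply/eq_initial => k.
rewrite ltnS leq_eqVlt => /orP[/eqP->//|kj].
by rewrite /coding (nn'.1 _ kj).
Qed.

Lemma first_diff_initial n n' j : differ_first b n n' j ->
  initial (coding n) j = initial (coding n') j.
Proof. by move=> nn'; apply/eq_initial => k kj; rewrite /coding (nn'.1 _ kj). Qed.

Section FromMapping.
Variable tau : seq 'I_q -> int.
Hypothesis tau_max : maximal_mapping b q_gt1 tau.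

Let tau_class w i : digits b (tau (rcons w i)) /\ residue (tau (rcons w i)) = i.
Proof. by apply/digit_classE; case: tau_max => _ _ /(_ w i). Qed.

(** Uniqueness of expansions: the series defining [Pi] is itself one. *)
Lemma digit_Pi s k : regular tau s ->
  digit (Pi b tau s) k = tau (initial s k.+1).
Proof.
move=> [N HN]; rewrite /Pi.
rewrite -(@fsbig_widen _ _ _ _ `I_N)//; last first.
  move=> i /= [_ /negP]; rewrite -leqNgt => Ni.
  by rewrite HN ?mul0r// (leq_trans Ni).
rewrite -(@fsbig_ord _ _ _ N (fun k => tau (initial s k.+1) * b%:Z ^+ k)).
rewrite (digit_sum b_gt2 (c := fun k => tau (initial s k.+1))); last first.
  by move=> i; case: tau_max.
by case: ltnP => // Nk; rewrite HN// (leq_trans Nk).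
Qed.

(** A label has the residue of the last letter of its word, so the letters can be
    recovered from the digits. *)
Lemma coding_Pi s : regular tau s -> coding (Pi b tau s) = s.
Proof.
move=> reg; apply/funext => k.
by rewrite /coding digit_Pi// initialS (tau_class _ _).2.
Qed.

(** An integer determines the only path along which it can be read: its coding. *)
Lemma follows_Pi n :
  follows tau n <-> exists2 s, Gamma q_gt1 s /\ regular tau s & Pi b tau s = n.
Proof.
split=> [fn|[s [_ reg] <-] k]; last by rewrite digit_Pi// coding_Pi.
have reg : regular tau (coding n).
  have [N HN] := digit_eventually0 b_gt2 n.
  by exists N.+1 => -[//|k] Nk; rewrite -fn; exact: HN.
exists (coding n); last by apply: (digit_inj b_gt2) => k; rewrite digit_Pi// fn.
split=> //; have [N HN] := coding_eventually0 n; exact: Gamma_eventually0 HN.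
Qed.

Lemma every_word_followed w :
  exists2 n, follows tau n & initial (coding n) (size w) = w.
Proof.
have [_ _ _ /(_ w)[w' reg]] := tau_max.
exists (Pi b tau (pad0 (w ++ w'))).
  by move=> k; rewrite digit_Pi// coding_Pi.
by rewrite coding_Pi// initial_pad0_cat// take_size.
Qed.

(** Maximality: where the digits of [n] first disagree with the labels along its
    coding, the digit and the label are still congruent modulo [q]. *)
Lemma follows_maximal : maximal_admissible (follows tau).
Proof.
split=> [n n' fn fn' nn'|n fn].
  have [j jd] := differ_first_exists b_gt2 nn'.
  apply/(first_diff_admissible jd) => cj; apply: jd.2.
  by rewrite fn fn' !initialS (first_diff_initial jd) cj.
have ex : exists k, digit n k != tau (initial (coding n) k.+1).
  apply: contrapT => /forallNP H; apply: fn => k.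
  by apply/eqP; apply/negPn/negP; exact: H.
case: (ex_minnP ex) => j /eqP jd jmin.
have [n' fn'] := every_word_followed (initial (coding n) j.+1).
rewrite size_initial => nn'; exists n' => //.
have jd' : differ_first b n n' j.
  split; last by rewrite fn' nn'.
  move=> k kj; rewrite fn'.
  have /eqP -> : digit n k == tau (initial (coding n) k.+1).
    by apply: contraTT kj => /jmin; rewrite -leqNgt.
  congr tau; apply/eq_initial => i ik.
  by move/eq_initial: nn' => -> //; exact: leq_trans ik (leqW kj).
rewrite (first_diff_admissible jd'); apply; by move/eq_initial: nn' => ->.
Qed.

End FromMapping.

Section FromSet.
Variable A : set int.
Hypotheses (A0 : A 0) (A_max : maximal_admissible A).

(** Otherwise admissibility would separate the letters at the first index where the
    digits differ. *)
Lemma digit_eq_initial a a' n : A a -> A a' ->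
  initial (coding a) n = initial (coding a') n ->
  forall k, (k < n)%N -> digit a k = digit a' k.
Proof.
move=> Aa Aa' /eq_initial same k kn; have [->//|/eqP aa'] := eqVneq a a'.
have /(differ_first_exists b_gt2)[j jd] := aa'.
have := A_max.1 _ _ Aa Aa' aa'; rewrite (first_diff_admissible jd) => cj.
apply: jd.1; apply: contra_notT cj; rewrite -leqNgt => jk.
exact: same (leq_ltn_trans jk kn).
Qed.

(** By induction on the word.  If [w] begins the coding of [a0] but [rcons w i] is
    not realized, the integer [n] with the digits of [a0] along [w], followed by
    the digit [i] and zeros, lies outside [A] but has admissible difference with
    every element of [A], against maximality. *)
Lemma every_word_coded w : exists2 a, A a & initial (coding a) (size w) = w.
Proof.
elim/last_ind: w => [|w i [a0 Aa0 a0w]]; first by exists 0.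
apply: contrapT => none.
have {}none a : A a -> ~ (initial (coding a) (size w).+1 = rcons w i).
  by move=> Aa aw; apply: none; exists a => //; rewrite size_rcons.
pose c k := if (k < size w)%N then digit a0 k else (i : nat)%:Z.
pose n := \sum_(k < (size w).+1) c k * b%:Z ^+ k.
have digit_n k : (k <= size w)%N -> digit n k = c k.
  move=> kw; rewrite digit_sum ?ltnS ?kw// => {kw}k; rewrite /c; case: ifP => _.
    exact: digits_digit.
  by rewrite /digits /=; have := ltn_ord i; lia.
have coding_n : initial (coding n) (size w).+1 = rcons w i.
  rewrite initialS -[in RHS]a0w; congr rcons.
    apply/eq_initial => k kw.
    by rewrite /coding digit_n ?(ltnW kw)// /c kw.
  by rewrite /coding digit_n// /c ltnn residue_ord.
have An : ~ A n by move=> /none.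
have [a Aa na] := A_max.2 _ An.
have nna : n <> a by move=> na'; apply: An; rewrite na'.
(* The codings of n and a agree up to and including j, where their digits first
   differ.  If j is not an index of w, then a realizes the longer word; otherwise
   a and a0 have the same coding up to j, hence the same digit there, which is
   also that of n. *)
have [j jd ja] := not_admissible_first_diff nna na.
have [jw|wj] := ltnP j (size w); last first.
  apply: (none _ Aa); rewrite -coding_n; apply/eq_initial => k kw.
  by move/eq_initial: ja => -> //; exact: leq_trans kw _.
apply: jd.2; rewrite digit_n ?(ltnW jw)// /c jw.
apply: (@digit_eq_initial _ _ j.+1) => //; rewrite -ja.
apply/eq_initial => k kj; have kw := leq_trans kj jw.
by rewrite /coding digit_n ?(ltnW kw)// /c kw.
Qed.

Definition witness w : int :=
  xget 0 [set a | A a /\ initial (coding a) (size w) = w].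

(** By [digit_eq_initial] the label does not depend on the choice of the witness. *)
Definition mapping_of (w : seq 'I_q) : int :=
  if w is [::] then 0 else digit (witness w) (size w).-1.

Lemma mapping_of_initial a k : A a ->
  mapping_of (initial (coding a) k.+1) = digit a k.
Proof.
move=> Aa; have wE : size (initial (coding a) k.+1) = k.+1 by rewrite size_initial.
rewrite /mapping_of; case E : (initial (coding a) k.+1) => [|i w].
  by move: wE; rewrite E.
rewrite -E wE /=; set w' := initial _ _.
have [a' Aa' a'w] := every_word_coded w'.
have [Ax xw] : [set a | A a /\ initial (coding a) (size w') = w'] (witness w').
  by apply: (xgetI 0 (x := a')); split.
apply: (@digit_eq_initial _ _ k.+1) => //; rewrite -[RHS]/w' -[RHS]xw.
by rewrite /w' size_initial.
Qed.

Lemma mapping_of_maximal : maximal_mapping b q_gt1 mapping_of.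
Proof.
split.
- case=> [|i w]; rewrite /mapping_of; [exact: digits0|exact: digits_digit].
- split=> // -[//|n] _.
  have -> : nseq n.+1 letter0 = initial (coding 0) n.+1.
    apply: (@eq_from_nth _ letter0); rewrite size_nseq ?size_initial// => k kn.
    by rewrite nth_nseq kn nth_mkseq// /coding digit_0// residue0.
  by rewrite mapping_of_initial// digit_0.
- move=> w i; have [a Aa aw] := every_word_coded (rcons w i).
  move: aw; rewrite size_rcons => aw; rewrite -{1}aw mapping_of_initial//.
  apply/digit_classE; split; first exact: digits_digit.
  by move: aw; rewrite initialS => /rcons_inj[].
- move=> w; have [a Aa aw] := every_word_coded w.
  have [N HN] := coding_eventually0 a.
  have [w' ww'] := initial_cut (coding a) (leq_maxl (size w) N).
  exists w'; rewrite -[in w ++ w']aw -ww' pad0_initial; last first.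
    by move=> k; rewrite geq_max => /andP[_ /HN].
  have [M HM] := digit_eventually0 b_gt2 a.
  exists M.+1 => -[//|k] Mk; rewrite mapping_of_initial//; exact: HM.
Qed.

Lemma mapping_of_follows n : A n <-> follows mapping_of n.
Proof.
split=> [An k|fn]; first by rewrite mapping_of_initial.
apply: contrapT => An; have [a Aa na] := A_max.2 _ An.
have nna : n <> a by move=> na'; apply: An; rewrite na'.
have [j jd ja] := not_admissible_first_diff nna na.
by apply: jd.2; rewrite fn ja mapping_of_initial.
Qed.

End FromSet.

Lemma maximal_admissibleP A : A 0 ->
  maximal_admissible A <-> exists2 tau, maximal_mapping b q_gt1 tau &
    A = [set Pi b tau s | s in [set s | Gamma q_gt1 s /\ regular tau s]].
Proof.
move=> A0; split=> [A_max|[tau tau_max ->]].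
  exists (mapping_of A); first exact: mapping_of_maximal.
  apply/seteqP; split=> n /=.
    move=> /(mapping_of_follows A0 A_max).
    exact: (follows_Pi (mapping_of_maximal A0 A_max) n).1.
  move=> /(follows_Pi (mapping_of_maximal A0 A_max) n).2.
  exact: (mapping_of_follows A0 A_max n).2.
suff -> : [set Pi b tau s | s in [set s | Gamma q_gt1 s /\ regular tau s]] =
    follows tau by exact: follows_maximal.
by apply/seteqP; split=> n /=; rewrite follows_Pi.
Qed.

End MaximalSets.

(** * Integrals against a self-similar probability *)

Section BoundedIntegrals.
Variables (R : realType) (d : measure_display) (T : measurableType d).
Variable P : probability T R.
Implicit Types f g : T -> R.

Lemma integrable_bounded1 f :
  measurable_fun [set: T] f -> (forall x, `|f x| <= 1) ->
  P.-integrable [set: T] (EFin \o f).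
Proof.
move=> mf f1; apply: measurable_bounded_integrable => //.
  exact: le_lt_trans (probability_le1 P measurableT) (ltry 1).
by exists 1; split=> // M M1 x _ /=; exact: le_trans (f1 x) (ltW M1).
Qed.

Lemma EFin_Rintegral f :
  measurable_fun [set: T] f -> (forall x, `|f x| <= 1) ->
  ((\int[P]_x f x)%R%:E = \int[P]_x (f x)%:E)%E.
Proof.
move=> mf f1; rewrite /Rintegral fineK//; apply: integrable_fin_num => //.
exact: integrable_bounded1.
Qed.

(** Adding 1 to a function bounded by 1 makes it nonnegative, which gives access to
    the theorems on integrals of nonnegative functions. *)
Lemma integral_1D f :
  measurable_fun [set: T] f -> (forall x, `|f x| <= 1) ->
  (\int[P]_x (1 + f x)%:E = (1 + \int[P]_x f x)%R%:E)%E.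
Proof.
move=> mf f1; under eq_integral do rewrite EFinD.
rewrite integralD//=; last 2 first.
- by apply: integrable_bounded1 => // x; rewrite normr1.
- exact: integrable_bounded1.
by rewrite integral_cst//= probability_setT mule1 -EFin_Rintegral.
Qed.

Lemma Rintegral_combination f g (c e : R) :
  measurable_fun [set: T] f -> (forall x, `|f x| <= 1) ->
  measurable_fun [set: T] g -> (forall x, `|g x| <= 1) ->
  \int[P]_x (c * f x + e * g x) = c * \int[P]_x f x + e * \int[P]_x g x.
Proof.
move=> mf f1 mg g1.
have If := integrable_bounded1 mf f1; have Ig := integrable_bounded1 mg g1.
rewrite RintegralD// ?RintegralZl//.
  exact: (integrableZl measurableT c If).
exact: (integrableZl measurableT e Ig).
Qed.

Variables (q : nat) (phi : nat -> T -> T).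
Hypotheses (q_gt0 : (0 < q)%N) (mphi : forall i, measurable_fun [set: T] (phi i)).
Hypothesis P_selfsimilar : forall E, measurable E ->
  P E = (\sum_(i < q) (q%:R^-1)%:E * P (phi i @^-1` E))%E.

(** The hypothesis says that [P] is the sum of the measures [q^-1] times the
    pushforward of [P] by [phi i]. *)
Lemma selfsimilar_ge0_integral (f : T -> \bar R) :
  measurable_fun [set: T] f -> (forall x, 0 <= f x)%E ->
  (\int[P]_x f x = \sum_(i < q) (q%:R^-1)%:E * \int[P]_x f (phi i x))%E.
Proof.
move=> mf f0.
have q_ge0 : 0 <= q%:R^-1 :> R by rewrite invr_ge0.
pose piece (i : nat) : {measure set T -> \bar R} :=
  mscale (NngNum q_ge0) (distribution P (mfun_Sub (mem_set (mphi i)))).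
rewrite (eq_measure_integral (msum piece q)); last first.
  by move=> E mE _; exact: P_selfsimilar.
rewrite ge0_integral_measure_sum//.
apply: eq_bigr => i _; rewrite ge0_integral_mscale//=.
by rewrite ge0_integral_pushforward.
Qed.

Lemma selfsimilar_Rintegral f :
  measurable_fun [set: T] f -> (forall x, `|f x| <= 1) ->
  \int[P]_x f x = q%:R^-1 * \sum_(i < q) \int[P]_x f (phi i x).
Proof.
move=> mf f1.
have mfi i : measurable_fun [set: T] (f \o phi i).
  exact: measurableT_comp.
have : (\int[P]_x (1 + f x)%:E =
    \sum_(i < q) (q%:R^-1)%:E * \int[P]_x (1 + f (phi i x))%:E)%E.
  apply: (selfsimilar_ge0_integral (f := fun x => (1 + f x)%:E)).
    by apply/measurable_EFinP; exact: measurable_funD.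
  by move=> x; rewrite lee_fin; move: (f1 x); rewrite ler_norml; lra.
rewrite integral_1D//.
rewrite (eq_bigr (fun i : 'I_q =>
    (q%:R^-1 * (1 + \int[P]_x f (phi i x))%R)%:E)); last first.
  by move=> i _; rewrite (integral_1D (f := f \o phi i))// => x; exact: f1.
rewrite sumEFin => -[]; rewrite -mulr_sumr big_split/= sumr_const card_ord.
rewrite mulrDr mulVf ?pnatr_eq0 -?lt0n//; exact: addrI.
Qed.

End BoundedIntegrals.

(** * Complex exponentials *)

Section Exponentials.
Variable R : realType.
Implicit Types s t x y : R.

Lemma expoDl s t x : expo (s + t) x = expo s x * expo t x.
Proof.
rewrite /expo !mulrDr mulrDl cosD sinD.
by apply/eqP; rewrite eq_complex /= !eqxx /= addrC mulrC eqxx.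
Qed.

Lemma expo_swap s x : expo s x = expo x s.
Proof. by rewrite /expo -!mulrA [s * x]mulrC. Qed.

Lemma expoDr t x y : expo t (x + y) = expo t x * expo t y.
Proof. by rewrite expo_swap expoDl !(expo_swap t). Qed.

Lemma expoM s t x : expo s (t * x) = expo (s * t) x.
Proof. by rewrite /expo !mulrA. Qed.

Lemma expo_conj t x : (expo t x)^*%C = expo (- t) x.
Proof. by rewrite /expo mulrN mulNr cosN sinN. Qed.

Lemma expo0 x : expo 0 x = 1.
Proof. by rewrite /expo mulr0 mul0r cos0 sin0. Qed.

Lemma expo_nat t n : expo t n%:R = expo t 1 ^+ n.
Proof.
elim: n => [|n IH]; first by rewrite expo_swap expo0 expr0.
by rewrite -natr1 expoDr IH exprSr.
Qed.

Lemma expo_int_period (m : int) : expo m%:~R 1 = 1 :> R[i].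
Proof.
have nat1 n : expo n%:R 1 = 1 :> R[i].
  rewrite expo_swap expo_nat -[RHS](expr1n _ n); congr (_ ^+ n).
  by rewrite /expo !mulr1 mulrC mulr_natr cos2pi sin2pi.
case: m => n; first exact: nat1.
rewrite NegzE mulrNz -[LHS]mul1r -{1}(nat1 n.+1) -expoDl.
by rewrite -[X in X - _]/((Posz n.+1)%:~R) subrr expo0.
Qed.

(** With [s] the fractional part of [t], cos (2 pi s) = 1 - 2 sin(pi s)^2, and the
    sine is positive unless [s = 0]. *)
Lemma expo_eq1 t : expo t 1 = 1 -> exists m : int, t = m%:~R.
Proof.
move=> t1; exists (Num.floor t); apply/eqP; rewrite -subr_eq0.
set s := t - _.
have : expo s 1 = 1.
  have := expoDl s (Num.floor t)%:~R 1.
  by rewrite subrK t1 expo_int_period mulr1.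
have s0 : 0 <= s by rewrite subr_ge0 floor_le_tmp.
have s1 : s < 1 by rewrite ltrBlDr addrC -intrD1 floorD1_gt.
move=> /eqP; rewrite eq_complex /= !mulr1 => /andP[/eqP cs _].
apply: contraTT s0 => sn0; rewrite -ltNge lt_neqAle sn0 /= leNgt.
apply/negP => sgt0.
have := @sin_gt0_pi R (pi * s); rewrite mulr_gt0 ?pi_gt0//=.
rewrite gtr_pMr ?pi_gt0// => /(_ s1).
move: cs; rewrite -mulrA mulr_natl cos_mulr2n => cs.
have := cos2Dsin2 (pi * s); nra.
Qed.

(** A geometric sum of ratio z = e^(2 pi i t): it vanishes iff z ^ q = 1 and z is
    not 1. *)
Lemma sum_expo_eq0 (q : nat) t : (0 < q)%N ->
  \sum_(i < q) expo t i%:R = 0 <->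
  exists m : int, ~~ (q %| m)%Z /\ t * q%:R = m%:~R.
Proof.
move=> q0; under eq_bigr do rewrite expo_nat.
set z := expo t 1; have := subrX1 z q; set S := (X in _ = _ * X) => zS.
have zqE : z ^+ q = expo (t * q%:R) 1.
  by rewrite -expo_nat -expoM mulr1.
split=> [S0|[m [qm tq]]].
  have : z ^+ q = 1 by apply/eqP; rewrite -subr_eq0 zS (S0 : S = 0) mulr0.
  rewrite zqE => /expo_eq1[m tq]; exists m; split=> //.
  apply/negP => /dvdzP[k mE].
  have tk : t = k%:~R.
    move: tq; rewrite mE intrM => /mulIf -> //.
    by rewrite pnatr_eq0 -lt0n.
  have z1 : z = 1 by rewrite /z tk expo_int_period.
  move: S0; rewrite z1; under eq_bigr do rewrite expr1n.
  by move=> /eqP; rewrite sumr_const card_ord pnatr_eq0 eqn0Ngt q0.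
have zq1 : z ^+ q = 1 by rewrite zqE tq expo_int_period.
move: zS; rewrite zq1 subrr => /esym/eqP; rewrite mulf_eq0 => /orP[|/eqP//].
rewrite subr_eq0 => /eqP/expo_eq1[k tk]; case/negP: qm.
apply/dvdzP; exists k; apply/eqP; rewrite -(eqr_int R) intrM -tk -tq.
by [].
Qed.

End Exponentials.

(** * Zeros of the Fourier transform *)

Section FourierTransform.
Import numFieldNormedType.Exports.
Variables (R : realType) (q b : nat) (mu : probability (measurableTypeR R) R).
Hypotheses (q_gt0 : (0 < q)%N) (mu_cantor : is_cantor_measure q b mu).

Definition fourier (xi : R) : R[i] := cintegral mu (expo xi).

Lemma L2_inner_expo s t : L2_inner mu (expo s) (expo t) = fourier (s - t).
Proof.
rewrite /L2_inner /fourier; congr (cintegral mu _); apply/funext => x.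
by rewrite expo_conj expoDl.
Qed.

Lemma measurable_ifs_map i :
  @measurable_fun _ _ (measurableTypeR R) (measurableTypeR R) setT
    (@ifs_map R b i).
Proof.
apply: continuous_measurable_fun => x; rewrite /ifs_map.
by apply: cvgM; [exact: cvg_cst|apply: cvgD; [exact: cvg_id|exact: cvg_cst]].
Qed.

Let continuous_scale (t : R) : continuous (fun x : R => 2 * pi * t * x).
Proof. by move=> x; apply: cvgM; [exact: cvg_cst|exact: cvg_id]. Qed.

Lemma measurable_cos_scale (t : R) :
  @measurable_fun _ _ (measurableTypeR R) R setT (fun x => cos (2 * pi * t * x)).
Proof.
apply: continuous_measurable_fun => x.
by apply: continuous_comp; [exact: continuous_scale|exact: continuous_cos].
Qed.

Lemma measurable_sin_scale (t : R) :
  @measurable_fun _ _ (measurableTypeR R) R setT (fun x => sin (2 * pi * t * x)).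
Proof.
apply: continuous_measurable_fun => x.
by apply: continuous_comp; [exact: continuous_scale|exact: continuous_sin].
Qed.

(** The Fourier transform of the uniform probability on 0, ..., q - 1. *)
Definition mask (t : R) : R[i] :=
  Complex q%:R^-1 0 * \sum_(i < q) expo t i%:R.

Lemma sum_Complex n (x y : 'I_n -> R) :
  \sum_i Complex (x i) (y i) = Complex (\sum_i x i) (\sum_i y i).
Proof.
pose K (u : R[i]) v w := u = Complex v w.
by apply: (big_ind3 K) => // _ v w _ v' w' -> ->.
Qed.

(** The map [ifs_map b i] multiplies [expo xi] by the phase [expo (xi / b) i]. *)
Lemma fourier_eq xi : fourier xi = mask (xi / b%:R) * fourier (xi / b%:R).
Proof.
set t := xi / b%:R.
have phase i x : 2 * pi * xi * ifs_map b i x = 2 * pi * t * i%:R + 2 * pi * t * x.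
  by rewrite /ifs_map /t; ring.
have Icos i : \int[mu]_x cos (2 * pi * xi * ifs_map b i x) =
    cos (2 * pi * t * i%:R) * \int[mu]_x cos (2 * pi * t * x) +
    - sin (2 * pi * t * i%:R) * \int[mu]_x sin (2 * pi * t * x).
  rewrite -Rintegral_combination.
  - by apply: eq_Rintegral => x _; rewrite phase cosD mulNr.
  - exact: measurable_cos_scale.
  - by move=> x; exact: cos_max.
  - exact: measurable_sin_scale.
  - by move=> x; exact: sin_max.
have Isin i : \int[mu]_x sin (2 * pi * xi * ifs_map b i x) =
    sin (2 * pi * t * i%:R) * \int[mu]_x cos (2 * pi * t * x) +
    cos (2 * pi * t * i%:R) * \int[mu]_x sin (2 * pi * t * x).
  rewrite -Rintegral_combination.
  - by apply: eq_Rintegral => x _; rewrite phase sinD.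
  - exact: measurable_cos_scale.
  - by move=> x; exact: cos_max.
  - exact: measurable_sin_scale.
  - by move=> x; exact: sin_max.
have selfsim := selfsimilar_Rintegral q_gt0 measurable_ifs_map mu_cantor.
rewrite {1}/fourier /cintegral /=.
rewrite (selfsim _ (measurable_cos_scale xi) (fun x => cos_max _)).
rewrite (selfsim _ (measurable_sin_scale xi) (fun x => sin_max _)).
rewrite (eq_bigr _ (fun (i : 'I_q) _ => Icos i)).
rewrite (eq_bigr _ (fun (i : 'I_q) _ => Isin i)).
rewrite !big_split/= -!mulr_suml sumrN.
rewrite /mask sum_Complex; apply/eqP; rewrite eq_complex /=.
by apply/andP; split; apply/eqP; ring.
Qed.

Hypothesis b_gt1 : (1 < b)%N.

(** The real parts tend to 1, the mass of [mu], by dominated convergence. *)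
Lemma fourier_nonzero_near0 xi : exists n, fourier (xi / b%:R ^+ n) <> 0.
Proof.
apply: contrapT => /forallNP zero.
have cos0E n : (\int[mu]_x (cos (2 * pi * (xi / b%:R ^+ n) * x))%:E = 0)%E.
  rewrite -EFin_Rintegral; last 2 first.
  - exact: measurable_cos_scale.
  - by move=> x; exact: cos_max.
  by have /contrapT := zero n; rewrite /fourier /cintegral => -[-> _].
have inv_b : b%:R^-1 ^+ n @[n --> \oo] --> (0 : R).
  apply: cvg_expr; rewrite ger0_norm ?invr_ge0//.
  by rewrite invf_lt1 ?ltr1n// ltr0n ltnW.
have phase0 x : 2 * pi * (xi / b%:R ^+ n) * x @[n --> \oo] --> (0 : R).
  have -> : (fun n => 2 * pi * (xi / b%:R ^+ n) * x) =
      (fun n => (2 * pi * xi * x) * b%:R^-1 ^+ n).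
    by apply/funext => n; rewrite exprVn; ring.
  rewrite -[X in _ --> X](mulr0 (2 * pi * xi * x)).
  by apply: cvgM => //; exact: cvg_cst.
have int1 : (\int[mu]_x 1%:E = 1%:E)%E.
  by rewrite integral_cst//= mul1e probability_setT.
have cvg1 : (\int[mu]_x (cos (2 * pi * (xi / b%:R ^+ n) * x))%:E)%E
    @[n --> \oo] --> (\int[mu]_x (1%:E))%E.
  apply: (@dominated_cvg _ _ _ mu _ _ _ _ (cst 1%E)) => //.
  - by move=> n; apply/measurable_EFinP; exact: measurable_cos_scale.
  - move=> x _; apply: cvg_EFin; first exact: nearW.
    have := cvg_comp _ _ (phase0 x) (@continuous_cos R 0); rewrite cos0; exact.
  - by apply: (@integrable_bounded1 _ _ _ mu (cst 1)) => // x; rewrite normr1.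
  - by move=> n x _; rewrite lee_fin cos_max.
move: cvg1; under eq_cvg do rewrite cos0E.
rewrite int1 => cvg1.
have /fine_cvg fcvg1 : cst 0%E @ \oo --> 1%:E := cvg1.
have : (0 : R) = 1.
  rewrite -(cvg_lim (@Rhausdorff R) fcvg1); apply/esym.
  exact: (cvg_lim (@Rhausdorff R) (cvg_cst _)).
by move=> /eqP; rewrite eq_sym oner_eq0.
Qed.

Lemma fourier_eq0 xi :
  fourier xi = 0 <-> exists j, mask (xi / b%:R ^+ j.+1) = 0.
Proof.
split=> [zero|[j]]; last first.
  elim: j xi => [|j IH] xi; rewrite fourier_eq.
    by rewrite expr1 => ->; rewrite mul0r.
  by rewrite exprS invfM mulrA => /IH ->; rewrite mulr0.
apply: contrapT => /forallNP nz; have [n] := fourier_nonzero_near0 xi; apply.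
elim: n => [|n IH]; first by rewrite expr0 divr1.
have step : xi / b%:R ^+ n / b%:R = xi / b%:R ^+ n.+1.
  by rewrite -[LHS]mulrA -invfM -exprSr.
move: IH; rewrite fourier_eq step => /eqP.
by rewrite mulf_eq0 => /orP[/eqP/nz//|/eqP].
Qed.

Lemma mask_eq0 t :
  mask t = 0 <-> exists m : int, ~~ (q %| m)%Z /\ t * q%:R = m%:~R.
Proof.
rewrite -sum_expo_eq0// /mask; split=> [/eqP|->]; last by rewrite mulr0.
rewrite mulf_eq0 => /orP[|/eqP//]; rewrite eq_complex/= invr_eq0.
by rewrite pnatr_eq0 eqn0Ngt q_gt0.
Qed.

(** The mask vanishes at xi / b ^ (j + 1) iff xi = (b ^ (j + 1) / q) m with [m] not
    divisible by [q], and b ^ (j + 1) / q = r b ^ j. *)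
Lemma L2_orthogonal_expo r s t : b = (q * r)%N ->
  L2_orthogonal mu (expo s) (expo t) <->
  exists n : int, admissible b q n /\ s - t = r%:R * n%:~R.
Proof.
move=> b_def; rewrite /L2_orthogonal L2_inner_expo fourier_eq0.
have q0 : q%:R != 0 :> R by rewrite pnatr_eq0 -lt0n.
have b0 : b%:R != 0 :> R by rewrite pnatr_eq0 -lt0n ltnW.
have bqr : b%:R = q%:R * r%:R :> R by rewrite b_def natrM.
have r0 : r%:R != 0 :> R by apply: contra_neq b0; rewrite bqr => ->; rewrite mulr0.
split=> [[j /mask_eq0[m [qm]]]|[n [[j [m [qm ->]]]]]] dE.
  exists (b%:Z ^+ j * m); split; first by exists j, m.
  rewrite intrM rmorphXn/= -dE exprS -pmulrn.
  have := expf_neq0 j b0; rewrite bqr; move: (_ ^+ j) => B B0.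
  by field; rewrite B0 q0 r0.
exists j; apply/mask_eq0; exists m; split=> //.
rewrite dE intrM rmorphXn/= exprS -pmulrn.
have := expf_neq0 j b0; rewrite bqr; move: (_ ^+ j) => B B0.
by field; rewrite B0 q0 r0.
Qed.

End FourierTransform.

(** * From real frequencies to integers *)

(** Since 0 belongs to [Lambda], every frequency orthogonal to all of [Lambda], and
    every other element of [Lambda], is [r] times an integer. *)
Lemma maximal_orthogonalP (R : realType) (q r b : nat)
    (mu : probability (measurableTypeR R) R) (Lambda : set R) :
  (0 < q)%N -> (1 < b)%N -> b = (q * r)%N -> is_cantor_measure q b mu ->
  Lambda 0 ->
  maximal_orthogonal mu Lambda <->
  exists2 A, maximal_admissible q b A & Lambda = [set r%:R * n%:~R | n in A].
Proof.
move=> q0 b1 b_def mu_cantor Lambda0.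
have orthE := L2_orthogonal_expo q0 mu_cantor b1 _ _ b_def.
have r0 : r%:R != 0 :> R.
  rewrite pnatr_eq0; apply: contraTneq b1 => r0; by rewrite b_def r0 muln0.
have scaleI (n n' : int) : r%:R * n%:~R = r%:R * n'%:~R :> R -> n = n'.
  by move=> /(mulfI r0)/intr_inj.
have orth_int n n' :
    L2_orthogonal mu (expo (r%:R * n%:~R)) (expo (r%:R * n'%:~R)) <->
    admissible b q (n - n').
  rewrite orthE; split=> [[k [kad]]|nad].
    by rewrite -mulrBr -rmorphB => /scaleI ->.
  by exists (n - n'); rewrite rmorphB mulrBr.
split=> [[orth max]|[A [adm max] LambdaE]].
  have LambdaE : Lambda = [set r%:R * n%:~R | n in [set n | Lambda (r%:R * n%:~R)]].
    apply/seteqP; split=> [l Ll|_ [n Ln <-]//].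
    have [->|l0] := eqVneq l 0; first by exists 0 => /=; rewrite mulr0.
    have /orthE[n [_]] := orth _ _ Ll Lambda0 l0; rewrite subr0 => lE.
    by exists n => //=; rewrite -lE.
  exists [set n | Lambda (r%:R * n%:~R)] => //; split=> [n n' Ln Ln' nn'|n Ln].
    apply/orth_int; apply: orth => //; apply/eqP => /scaleI; exact: nn'.
  have [l] := max _ Ln; rewrite {1}LambdaE => -[n' Ln' <-] nn'.
  by exists n' => // /orth_int.
split=> [l l'|a La].
  rewrite LambdaE => -[n An <-] [n' An' <-] nn'; apply/orth_int; apply: adm => //.
  by move=> nE; move: nn'; rewrite nE eqxx.
apply: contrapT => none.
have orth l : Lambda l -> L2_orthogonal mu (expo a) (expo l).
  by move=> Ll; apply: contrapT => al; apply: none; exists l.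
have /orthE[n [_]] := orth _ Lambda0; rewrite subr0 => aE.
have An : ~ A n by move=> An; apply: La; rewrite LambdaE; exists n.
have [n' An'] := max _ An; apply; apply/orth_int; rewrite -aE; apply: orth.
by rewrite LambdaE; exists n'.
Qed.

Theorem theorem2p6 (R : realType) (q r b : nat) (q_ge2 : (2 <= q)%N)
    (r_ge2 : (2 <= r)%N) (b_def : b = (q * r)%N)
    (mu : probability (measurableTypeR R) R)
    (mu_def : is_cantor_measure q b mu)
    (Lambda : set R) (Lambda_countable : countable Lambda)
    (Lambda0 : Lambda 0) :
  maximal_orthogonal mu Lambda <->
  exists2 tau : seq 'I_q -> int, maximal_mapping b q_ge2 tau &
    Lambda = [set r%:R * l | l in Lambda_of b q_ge2 R tau].
Proof.
have q_gt0 : (0 < q)%N by exact: ltnW.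
have q_lt_b : (q < b)%N by rewrite b_def -[X in (X < _)%N]muln1 ltn_pmul2l.
have q_dvd_b : (q %| b)%N by rewrite b_def dvdn_mulr.
have b_gt1 : (1 < b)%N by exact: ltn_trans q_lt_b.
rewrite (maximal_orthogonalP q_gt0 b_gt1 b_def mu_def Lambda0).
have zero_in (A : set int) : Lambda = [set r%:R * n%:~R | n in A] -> A 0.
  move: Lambda0 => /[swap] -> [n An /eqP].
  rewrite mulf_eq0 pnatr_eq0 intr_eq0 => /orP[/eqP r0|/eqP <-//].
  by move: r_ge2; rewrite r0.
have imageE tau : [set r%:R * l | l in Lambda_of b q_ge2 R tau] =
    [set r%:R * n%:~R | n in
      [set Pi b tau s | s in [set s | Gamma q_ge2 s /\ regular tau s]]].
  by rewrite /Lambda_of !image_comp.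
have maxP A (A0 : A 0) := maximal_admissibleP q_ge2 q_lt_b q_dvd_b A0.
split=> [[A A_max LambdaE]|[tau tau_max LambdaE]].
  have [tau tau_max AE] := (maxP _ (zero_in _ LambdaE)).1 A_max.
  by exists tau => //; rewrite imageE -AE.
rewrite imageE in LambdaE.
exists (Pi b tau @` [set s | Gamma q_ge2 s /\ regular tau s]) => //.
by apply/(maxP _ (zero_in _ LambdaE)); exists tau.
Qed.
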